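(* Let $p$ be a prime, $n\ge 1$, let $G$ be an extraspecial group of order $p^{2n+1}$ with center $Z=Z(G)$, and let $B\colon G\to G$ be a Rota--Baxter operator on $G$. Then $B(Z)\subseteq Z$.
   Context: A Rota--Baxter operator on a group $G$ is a map $B\colon G\to G$ such that $B(g)B(h)=B\big(gB(g)hB(g)^{-1}\big)$ for all $g,h\in G$. A $p$-group $G$ is called extraspecial if $|Z(G)|=p$ and $G/Z(G)\cong \mathbb{Z}_p\oplus\dots\oplus\mathbb{Z}_p$. *)

(* Defs.v *)
From mathcomp Require Import all_boot all_fingroup all_solvable.

Set Implicit Arguments.
Unset Strict Implicit.
Unset Printing Implicit Defensive.

Import GroupScope.

(* [B] is only constrained on [G]; its values outside [G] are junk. *)
Definition rota_baxter (gT : finGroupType) (G : {set gT}) (B : gT -> gT) :=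
  {in G, forall g, B g \in G} /\
  {in G &, forall g h, B g * B h = B (g * B g * h * (B g)^-1)}.

(* On groups of order p^(2n+1) with n >= 1, [extraspecial] ('Phi(G) = G' = 'Z(G)
   of prime order) amounts to: 'Z(G) has order p and G / 'Z(G) is a direct sum
   of copies of Z/p. *)
Lemma extraspecialE (gT : finGroupType) (p n : nat) (G : {group gT}) :
    prime p -> 0 < n -> #|G| = (p ^ (2 * n + 1))%N ->
  extraspecial G <-> #|'Z(G)| = p /\ p.-abelem (G / 'Z(G)).
Proof.
move=> p_pr n_gt0 oG.
have pG: p.-group G by rewrite /pgroup oG pnatX pnat_id.
split=> [esG | [oZ abGZ]].
  split; first exact: card_center_extraspecial pG esG.
  by case: esG => [[<- _] _]; apply: Phi_quotient_abelem.
have nZG: G \subset 'N('Z(G)) by apply: normal_norm (center_normal G).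
have not_abG: ~~ abelian G.
  apply/negP=> /center_idP ZG; move: oZ; rewrite ZG oG => /eqP.
  rewrite -[X in _ == X]expn1 eqn_exp2l ?prime_gt1 //.
  by rewrite addn1 eqSS muln_eq0 /= eqn0Ngt n_gt0.
have sG'Z: G^`(1) \subset 'Z(G) by rewrite der1_min ?(abelem_abelian abGZ).
have defG': G^`(1) = 'Z(G).
  apply/eqP; rewrite eqEsubset sG'Z /=.
  have := prime_meetG (G := 'Z(G)) (H := G^`(1)%G); rewrite oZ => /(_ p_pr).
  apply; rewrite (setIidPr sG'Z).
  by apply: contra not_abG => /eqP G1; apply/derG1P.
have sPhiZ: 'Phi(G) \subset 'Z(G).
  by rewrite (Phi_min pG).
split; last by rewrite oZ.
split=> //; apply/eqP; rewrite eqEsubset sPhiZ -defG' (Phi_joing pG).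
exact: joing_subl.
Qed.

(* Main.v *)
Require Import Defs.
From mathcomp Require Import all_boot all_fingroup all_solvable.

Import GroupScope.

(* For [z] central and [h] in [G], expanding [B z * B h] in two ways shows that
   [B] maps the commutator of [h] and [(B z)^-1] to that of [B h] and
   [(B z)^-1], hence into G' = 'Z(G).  If [B z] is not central, a suitable [h]
   makes the former commutator a generator of the prime-order group 'Z(G), on
   which [B] is multiplicative, so [B z] is central after all. *)

(** Conjugation by [B h] in the Rota--Baxter identity fixes the central [z]. *)
Lemma rota_baxter_mul_center (gT : finGroupType) (G : {group gT})
    (B : gT -> gT) h z :
  rota_baxter G B -> h \in G -> z \in 'Z(G) -> B (h * z) = B h * B z.
Proof.
case=> BG mulB Gh /centerP[Gz cz].
by rewrite mulB // -!mulgA (mulgA (B h)) -(cz _ (BG _ Gh)) mulgK.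
Qed.

Lemma rota_baxter_expg_center (gT : finGroupType) (G : {group gT})
    (B : gT -> gT) z k :
  rota_baxter G B -> z \in 'Z(G) -> B (z ^+ k) = B z ^+ k.
Proof.
move=> rbB Zz; have Gz := subsetP (center_sub G) z Zz.
elim: k => [|k IHk].
  (* [B 1] is idempotent, hence trivial. *)
  by apply: (mulgI (B 1)); rewrite -(rota_baxter_mul_center _ G B) ?group1 ?mulg1.
by rewrite !expgSr (rota_baxter_mul_center _ G B) ?groupX // IHk.
Qed.

Lemma rota_baxter_commg_center (gT : finGroupType) (G : {group gT})
    (B : gT -> gT) z h :
    rota_baxter G B -> z \in 'Z(G) -> h \in G -> [~ h, (B z)^-1] \in 'Z(G) ->
  B [~ h, (B z)^-1] = [~ B h, (B z)^-1].
Proof.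
move=> rbB Zz Gh Zc; have [_ mulB] := rbB; have /centerP[Gz cz] := Zz.
have Gc := subsetP (center_sub G) _ Zc.
have := mulB _ _ Gz Gh.
(* Conjugating [h] by [(B z)^-1] multiplies it on the right by the commutator; this factor and [z]
   are central, so [B] splits over the product. *)
have ->: z * B z * h * (B z)^-1 = h * ([~ h, (B z)^-1] * z).
  rewrite -(cz _ Gc) [RHS]mulgA -(cz _ Gh) commgEl conjgE invgK.
  by rewrite -!mulgA mulKVg.
rewrite (rota_baxter_mul_center _ G B h) ?(groupM Zc) //.
rewrite (rota_baxter_mul_center _ G B) // => eqB.
by rewrite [RHS]commgEl conjgE invgK [B z * _]mulgA eqB [B h * _]mulgA mulgK mulKg.
Qed.

Theorem theorem1 (gT : finGroupType) (G : {group gT}) (p n : nat)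
    (B : gT -> gT) (p_pr : prime p) (n_ge1 : 1 <= n)
    (oG : #|G| = (p ^ (2 * n + 1))%N) (esG : extraspecial G)
    (rbB : rota_baxter G B) :
  B @: 'Z(G) \subset 'Z(G).
Proof.
have [[_ defG'] prZ] := esG; have [BG _] := rbB.
have comZ x y : x \in G -> y \in G -> [~ x, y] \in 'Z(G).
  by move=> Gx Gy; rewrite -defG' mem_commg.
apply/subsetP=> _ /imsetP[z Zz ->].
have Gb : B z \in G by rewrite BG ?(subsetP (center_sub G)).
apply: contraT => notZb.
have /subsetPn[h Gh ncbh] : ~~ (G \subset 'C[(B z)^-1]).
  apply: contra notZb => /subsetP cGb; rewrite -groupV.
  apply/centerP; split=> [|y Gy]; first by rewrite groupV.
  by have /cent1P := cGb y Gy.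
pose c := [~ h, (B z)^-1].
have Zc : c \in 'Z(G) by rewrite comZ ?groupV.
have c_neq1 : c != 1.
  by apply: contra ncbh => /commgP cbh; apply/cent1P/commute_sym.
(* [<[c]>] is a nontrivial subgroup of the prime-order group ['Z(G)], hence all of it. *)
have /cyclePmin[k _ def_z] : z \in <[c]>.
  apply: (subsetP _ _ Zz); apply: prime_meetG prZ _.
  by rewrite (setIidPr _) ?cycle_subG // cycle_eq1.
(* [B z] is a power of [B c], which is a commutator in [G] and so central. *)
case/negP: notZb; rewrite def_z (rota_baxter_expg_center _ G B) // groupX //.
by rewrite (rota_baxter_commg_center _ G B) // comZ ?groupV // BG.
Qed.
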